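(* Let $|x|<1$, $|q|<1$. Let $A=(a_1,a_2,a_3,\dots)$ be a sequence of natural numbers and $B=\{b_1,b_2,b_3,\dots\}\subseteq\mathbb N$ (with the $b_i$ distinct). Then $$\prod_{n=1}^\infty\frac{1}{1-x^{a_n}q^{a_nb_n}}=\sum_{\lambda\in\mathcal P_B(A)}x^{\ell(\lambda)}q^{|\lambda|}=\sum_{n=0}^\infty x^n\sum_{\lambda\in\mathcal P_B(A,n)}q^{|\lambda|}.$$ Moreover, if the $a_i$ are distinct, then the sets $\mathcal P_A$ and $\mathcal P_B(A)$ are in bijection, and for every $n\ge0$, $\#\mathcal P_B(A,n)=p_A(n)$.
   Context: For a partition $\lambda$, $|\lambda|$ is its size, $\ell(\lambda)$ its number of parts, and $m_k(\lambda)$ the multiplicity of $k$ as a part. For a set (or a sequence of distinct natural numbers) $T=\{t_1,t_2,\dots\}$, $\mathcal P_T$ is the set of partitions (including the empty partition) all of whose parts lie in $T$, and $p_T(n)$ is the number of partitions of $n$ in $\mathcal P_T$. For a sequence $S=(s_1,s_2,\dots)$ of natural numbers, $\mathcal P_T(S)=\{\lambda\in\mathcal P_T: s_i\mid m_{t_i}(\lambda)\text{ for all }i\}$, and $\mathcal P_T(S,n)$ is the set of partitions in $\mathcal P_T(S)$ of length $n$. Thus $\mathcal P_B(A)$ consists of partitions with parts in $B$ in which the multiplicity of $b_i$ is divisible by $a_i$ for every $i$. *)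

(* Defs.v *)
From HB Require Import structures.
From mathcomp Require Import all_boot all_order all_algebra finmap.
From mathcomp Require Import complex.
From mathcomp Require Import boolp classical_sets functions cardinality reals.
From mathcomp Require Import topology normedtype sequences summability.

Set Implicit Arguments.
Unset Strict Implicit.
Unset Printing Implicit Defensive.

Import Order.TTheory GRing.Theory Num.Theory numFieldNormedType.Exports.

Local Open Scope classical_set_scope.
Local Open Scope card_scope.
Local Open Scope ring_scope.
Local Open Scope complex_scope.

(* [R[i]] carries no topology of its own; seen as a [numFieldType], it gets the
   one induced by the modulus through [numFieldNormedType]. *)
Definition C (R : realType) : numFieldType := R[i].

#[export] Existing Instance totally_filter.

Record intpart := IntPart {
  parts :> seq nat;
  _ : sorted geq parts && (0%N \notin parts) }.

HB.instance Definition _ := [isSub for parts].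
HB.instance Definition _ := [Choice of intpart by <:].

Definition psize (l : intpart) : nat := sumn l.

Definition plength (l : intpart) : nat := size l.

Definition mult (k : nat) (l : intpart) : nat := count_mem k l.

Definition parts_in (T : set nat) : set intpart :=
  [set l : intpart | forall k, k \in parts l -> T k].

Definition parts_in_of (T : set nat) (n : nat) : set intpart :=
  parts_in T `&` [set l | psize l = n].

Lemma finite_parts_in_of (T : set nat) (n : nat) :
  finite_set (parts_in_of T n).
Proof.
suff: finite_set [set l | psize l = n] by apply: sub_finite_set => l [].
pose h (u : n.-bseq 'I_n.+1) : intpart :=
  insubd (@IntPart [::] isT) [seq val i | i <- u].
apply: sub_finite_set (finite_image h (@finite_finset _ setT)) => l /= ln.
have sz : (size l <= n)%N.
  have : 0%N \notin parts l by case/andP: (valP l).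
  rewrite -ln /psize; elim: (parts l) => //= k s IH.
  rewrite inE negb_or eq_sym -lt0n => /andP[k0 /IH ss].
  by rewrite -add1n leq_add.
have le k : k \in parts l -> (k < n.+1)%N.
  rewrite ltnS -ln /psize; elim: (parts l) => //= j s IH.
  rewrite inE => /orP[/eqP->|/IH ks]; first exact: leq_addr.
  exact: leq_trans ks (leq_addl _ _).
have szi : (size [seq inord k : 'I_n.+1 | k <- parts l] <= n)%N.
  by rewrite size_map.
exists (Bseq szi) => //; apply: val_inj; rewrite /h /= val_insubd -map_comp.
have -> : [seq (val \o (@inord n)) k | k <- parts l] = parts l.
  by rewrite -[RHS]map_id; apply/eq_in_map => k kl /=; rewrite inordK ?le.
by rewrite (valP l).
Qed.

(* The default value of [fset_set] never occurs, by [finite_parts_in_of]. *)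
Definition npart (T : set nat) (n : nat) : nat :=
  #|` fset_set (parts_in_of T n)|%fset.

(* Sequences are indexed from 0: [t i] and [s i] stand for the (i+1)-st terms. *)
Definition parts_in_mult (t s : nat -> nat) : set intpart :=
  parts_in (range t) `&` [set l | forall i, (s i %| mult (t i) l)%N].

Definition parts_in_mult_len (t s : nat -> nat) (n : nat) : set intpart :=
  parts_in_mult t s `&` [set l | plength l = n].

(* Unconditional summation: convergence of the net of finite partial sums. *)
Definition has_sum (I : choiceType) (K : numDomainType) (V : normedModType K)
    (A : set I) (f : I -> V) (s : V) : Prop :=
  partial_sum (fun i : A => f (val i)) @ totally --> s.

(* Main.v *)
Require Import Defs.
From HB Require Import structures.
From mathcomp Require Import all_boot all_order all_algebra finmap.
From mathcomp Require Import complex.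
From mathcomp Require Import boolp classical_sets functions cardinality reals.
From mathcomp Require Import topology normedtype sequences summability.
From mathcomp Require Import exp.

(** Every family at hand is dominated by [r ^ |l|] with [r = |q| < 1], whose
    finite sums over partitions are at most [prod_i (1 + r^i + r^(2i) + ...)],
    which is finite; so all sums converge unconditionally and may be
    rearranged. Let [S_N] be the sum over the admissible partitions with parts
    among [b_0, ..., b_(N-1)]. Those using [b_N] arise from an arbitrary
    admissible one with parts among [b_0, ..., b_N] by adding [a_N] copies of
    [b_N], so [S_(N+1) = S_N + x^a_N q^(a_N b_N) S_(N+1)], which gives the
    partial products. The product and the power series in [x] both converge to
    the full sum because they sum over increasing exhaustions of the
    admissible partitions. When [a] is injective, replacing each part [a_i] by
    [a_i] copies of [b_i] is a bijection that turns size into length. *)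

Import Order.TTheory GRing.Theory Num.Theory numFieldNormedType.Exports.

Local Open Scope classical_set_scope.
Local Open Scope card_scope.
Local Open Scope ring_scope.
Local Open Scope complex_scope.

(** Extending by zero puts families over different sets of partitions on one index type, where they
    can be added and compared. *)
Local Notation zext A f := (patch (fun=> 0) A f).

(** * Unconditional sums in normed modules *)

Section UnconditionalSums.
Context {K : numFieldType} {V : normedModType K}.

Lemma partial_sumE {I : choiceType} (g : I -> V) (J : {fset I}) :
  partial_sum g J = \sum_(i <- J) g i.
Proof. by rewrite /partial_sum big_seq_fsetE. Qed.

Lemma usumP {I : choiceType} (g : I -> V) (s : V) :
  partial_sum g @ totally --> s <->
  forall e : K, 0 < e -> exists J : {fset I},
    forall L : {fset I}, (J `<=` L)%fset -> `|s - \sum_(i <- L) g i| < e.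
Proof.
split=> [/cvgrPdist_lt gs e e0|gs].
  have [J _ JP] := gs e e0; exists J => L JL.
  by rewrite -partial_sumE; exact: JP.
apply/cvgrPdist_lt => e e0; have [J JP] := gs e e0.
by exists J => // L JL; rewrite /= partial_sumE; exact: JP.
Qed.

Lemma usum_unique {I : choiceType} (g : I -> V) (s t : V) :
  partial_sum g @ totally --> s -> partial_sum g @ totally --> t -> s = t.
Proof. by move=> gs gt; apply: (cvg_unique _ gs gt); exact: norm_hausdorff. Qed.

Lemma usumD {I : choiceType} (f g : I -> V) (s t : V) :
  partial_sum f @ totally --> s -> partial_sum g @ totally --> t ->
  partial_sum (fun i => f i + g i) @ totally --> s + t.
Proof.
move=> fs gt; rewrite (_ : partial_sum _ = partial_sum f \+ partial_sum g).
  exact: cvgD.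
by apply/funext => J; rewrite /partial_sum /= big_split.
Qed.

Lemma usumZ {I : choiceType} (k : K) (g : I -> V) (s : V) :
  partial_sum g @ totally --> s ->
  partial_sum (fun i => k *: g i) @ totally --> k *: s.
Proof.
move=> gs; rewrite (_ : partial_sum _ = k \*: partial_sum g); first exact: cvgZr.
by apply/funext => J; rewrite /partial_sum /= scaler_sumr.
Qed.

Lemma usumB {I : choiceType} (f g : I -> V) (s t : V) :
  partial_sum f @ totally --> s -> partial_sum g @ totally --> t ->
  partial_sum (fun i => f i - g i) @ totally --> s - t.
Proof.
move=> fs gt; rewrite -scaleN1r.
rewrite (_ : (fun i => _) = (fun i => f i + -1 *: g i)).
  by apply: usumD => //; exact: usumZ.
by apply/funext => i; rewrite scaleN1r.
Qed.

(** Let [L] contain the preimage of [A]. A point of [A] outside the image of [L] is then outside the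
    range of [h], so [g] vanishes there. Hence the sum over [L] equals the sum of [g] over the union
    of [A] and the image of [L]. *)
Lemma usum_comp_inj {I J : choiceType} (h : I -> J) (g : J -> V) (s : V) :
  injective h -> (forall j, g j != 0 -> range h j) ->
  partial_sum g @ totally --> s -> partial_sum (g \o h) @ totally --> s.
Proof.
move=> hinj gh /usumP gs; apply/usumP => e /gs[A AP].
have fA : finite_set (h @^-1` [set` A]).
  by apply: finite_preimage => // i j _ _; exact: hinj.
exists (fset_set (h @^-1` [set` A])) => L AL.
have -> : \sum_(i <- L) (g \o h) i = \sum_(j <- (A `|` h @` L)%fset) g j.
  rewrite fsetUC -(big_fset_incl _ (fsubsetUl (h @` L)%fset A)).
    by rewrite big_imfset //= => i j _ _; exact: hinj.
  move=> j; rewrite inE => /orP[->//|jA jL].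
  apply/eqP/negP => /negP/gh[i _ hij]; move/negP: jL; apply.
  rewrite -hij in_imfset //; apply: (fsubsetP AL).
  by rewrite in_fset_set // inE /= hij.
by apply: AP; exact: fsubsetUl.
Qed.

Lemma has_sum_patch {I : choiceType} (A : set I) (f : I -> V) (s : V) :
  partial_sum (zext A f) @ totally --> s -> has_sum A f s.
Proof.
move=> fs; rewrite /has_sum.
rewrite (_ : (fun i : A => _) = zext A f \o val); last first.
  by apply/funext => i /=; rewrite /patch (valP i).
apply: usum_comp_inj fs; first exact: val_inj.
move=> i; rewrite /patch; case: ifPn => [iA _|_]; last by rewrite eqxx.
by exists (SigSub iA).
Qed.

(** Each [gn n] is [g] cut off to some set of indices, and every index is eventually kept. *)
Lemma usum_exhaustion {I : choiceType} (g : I -> V) (gn : nat -> I -> V)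
    (s : V) (sn : nat -> V) :
  (forall n i, gn n i = g i \/ gn n i = 0) ->
  (forall i, \forall n \near \oo, gn n i = g i) ->
  partial_sum g @ totally --> s ->
  (forall n, partial_sum (gn n) @ totally --> sn n) ->
  sn @ \oo --> s.
Proof.
move=> gng gnev /usumP gs gnsn; apply/cvgrPdist_lt => e e0.
have e20 : 0 < e / 2 by rewrite divr_gt0.
have [J JP] := gs _ e20.
have [N _ NP] : \forall n \near \oo, forall i, i \in J -> gn n i = g i.
  elim/fset1U_rect: J {JP} => [|i J _ IH]; first by apply: nearW => n i; rewrite inE.
  near=> n => j; rewrite 2!inE => /orP[/eqP->|].
    by near: n.
  by move: j; near: n.
exists N => // n /= Nn.
have /usumP/(_ _ e20)[J' J'P] := gnsn n.
(* [L] is large enough for [sn n]. Dropping the indices where [gn n] vanishes but [g] does not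
   leaves [L'], with the same sum; it still contains [J], so it is large enough for [s]. *)
pose L := (J `|` J')%fset; pose L' := [fset i in L | gn n i == g i]%fset.
have LL' : \sum_(i <- L) gn n i = \sum_(i <- L') g i.
  rewrite (big_fsetID _ (fun i => gn n i == g i)) /= [X in _ + X]big1_fset ?addr0.
    by apply: eq_big_seq => i; rewrite !inE => /andP[_ /eqP].
  move=> i; rewrite !inE => /andP[_ gi] _.
  by have [/eqP|//] := gng n i; rewrite (negbTE gi).
have JL' : (J `<=` L')%fset.
  apply/fsubsetP => i iJ; rewrite !inE iJ /=; apply/eqP; exact: NP.
rewrite -(subrK (\sum_(i <- L') g i) s) -addrA (splitr e).
apply: le_lt_trans (ler_normD _ _) _.
rewrite ltrD //; first exact: JP.
by rewrite -LL' distrC J'P // fsubsetUr.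
Unshelve. all: by end_near. Qed.

End UnconditionalSums.

(** * Dominated families of complex numbers *)

Section ComplexSums.
Context {R : realType} {I : choiceType}.

(** The sum is the supremum of the finite sums: a nearly optimal finite set stays nearly optimal
    when enlarged. *)
Lemma usum_nneg (u : I -> R) (M : R) :
  (forall i, 0 <= u i) -> (forall J : {fset I}, \sum_(i <- J) u i <= M) ->
  exists s : C R, partial_sum (fun i => (u i)%:C : C R) @ totally --> s.
Proof.
move=> u0 uM; pose E := [set \sum_(i <- J) u i | J in [set: {fset I}]].
have supE : has_sup E.
  split; first by exists (\sum_(i <- fset0) u i), fset0.
  by exists M => _ [J _ <-]; exact: uM.
exists ((sup E)%:C : C R); apply/usumP => e e0.
have eE : e = (complex.Re e)%:C by rewrite RRe_real // gtr0_real.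
rewrite eE in e0 *; rewrite ltcR in e0.
have [_ [J _ <-] JP] := sup_adherent e0 supE.
exists J => L JL; rewrite -(rmorph_sum (real_complex R)) -rmorphB /=.
have LE : \sum_(i <- L) u i <= sup E by apply: sup_upper_bound => //; exists L.
rewrite ger0_norm ?ler0c ?subr_ge0 // ltcR ltrBlDl -ltrBlDr.
apply: lt_le_trans JP _.
rewrite [leRHS](big_fsetID _ (mem J)) /=.
rewrite (_ : [fset x in L | x \in J]%fset = J) ?lerDl ?sumr_ge0 //.
by apply/fsetP => i; rewrite !inE andb_idl // => /(fsubsetP JL).
Qed.

(** Write [v] as [(v + u) - u]: both families are nonnegative, with finite sums at most [M + M] and
    [M]. *)
Lemma usum_real_dominated (v u : I -> R) (M : R) :
  (forall i, `|v i| <= u i) -> (forall J : {fset I}, \sum_(i <- J) u i <= M) ->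
  exists s : C R, partial_sum (fun i => (v i)%:C : C R) @ totally --> s.
Proof.
move=> vu uM; have u0 i : 0 <= u i by apply: le_trans (vu i).
have vu0 i : 0 <= v i + u i by rewrite -lerBlDr sub0r; exact: lerNnormlW.
have [t tP] := usum_nneg _ _ u0 uM.
have [s sP] : exists s : C R,
    partial_sum (fun i => (v i + u i)%:C : C R) @ totally --> s.
  apply: (usum_nneg _ (M + M)) => // J; rewrite big_split /= lerD //.
  by apply: le_trans (uM J); apply: ler_sum => i _; exact: ler_normlW.
exists (s - t); have := usumB _ _ _ _ sP tP.
rewrite (_ : (fun i => _) = (fun i => (v i)%:C : C R)) //.
by apply/funext => i; rewrite -rmorphB /= addrK.
Qed.

Lemma usum_dominated (g : I -> C R) (u : I -> R) (M : R) :
  (forall i, `|g i| <= (u i)%:C) ->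
  (forall J : {fset I}, \sum_(i <- J) u i <= M) ->
  exists s : C R, partial_sum g @ totally --> s.
Proof.
move=> gu uM.
have [i|s sP] := usum_real_dominated (fun i => complex.Re (g i)) u M _ uM.
  by rewrite -lecR; apply: le_trans (normc_ge_Re _) (gu i).
have [i|t tP] := usum_real_dominated (fun i => complex.Im (g i)) u M _ uM.
  (* Multiplication by ['i] moves the imaginary part, up to sign, into the real part and keeps the
     modulus. *)
  rewrite -lecR -normrN -ReiNIm; apply: le_trans (normc_ge_Re _) _.
  by rewrite normrM complexiE normCi mulr1; exact: gu.
have := usumD _ _ _ _ sP (usumZ ('i : C R) _ _ tP).
rewrite (_ : (fun i => _) = g); first by exists (s + 'i *: t).
by apply/funext => i; rewrite [RHS]complexE.
Qed.

End ComplexSums.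

(** * Multiplicities and sizes of partitions *)

Lemma intpart_ext (l m : intpart) :
  (forall k, (0 < k)%N -> mult k l = mult k m) -> l = m.
Proof.
move=> lm; apply: val_inj => /=.
have [/andP[sl l0] /andP[sm m0]] := (valP l, valP m).
(* A weakly decreasing list is determined by its multiset of entries, and 0 is never an entry. *)
apply: (@sorted_eq _ geq) => //.
- by move=> j i k ij jk; apply: leq_trans jk ij.
- by move=> i j; rewrite andbC; exact: anti_leq.
rewrite /perm_eq; apply/allP => -[|k] _ /=; last by rewrite -/(mult k.+1 l) lm.
by rewrite (count_memPn l0) (count_memPn m0).
Qed.

Lemma leq_size_sumn (s : seq nat) : 0%N \notin s -> (size s <= sumn s)%N.
Proof.
elim: s => //= k s IH; rewrite inE negb_or eq_sym -lt0n => /andP[k0 /IH ss].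
by rewrite -add1n leq_add.
Qed.

Lemma leq_mem_sumn (s : seq nat) (k : nat) : k \in s -> (k <= sumn s)%N.
Proof.
elim: s => //= j s IH; rewrite inE => /orP[/eqP->|/IH ks]; first exact: leq_addr.
exact: leq_trans ks (leq_addl _ _).
Qed.

Lemma leq_plength_psize (l : intpart) : (plength l <= psize l)%N.
Proof. by apply: leq_size_sumn; case/andP: (valP l). Qed.

Lemma leq_mult_psize (k : nat) (l : intpart) : (mult k l <= psize l)%N.
Proof. exact: leq_trans (count_size _ _) (leq_plength_psize l). Qed.

Lemma mult_gt_psize (k : nat) (l : intpart) : (psize l < k)%N -> mult k l = 0%N.
Proof.
move=> lk; apply/count_memPn; apply: contraL lk => /leq_mem_sumn.
by rewrite -leqNgt.
Qed.

Lemma sumn_count_mem (n : nat) (s : seq nat) : all (fun k => k <= n)%N s ->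
  sumn s = (\sum_(i < n) i.+1 * count_mem i.+1 s)%N.
Proof.
elim: s => [|k s IH] /=; first by rewrite big1 // => i _; rewrite muln0.
case/andP=> kn /IH ->.
rewrite (eq_bigr _ (fun i _ => mulnDr _ _ _)) [RHS]big_split /=.
congr (_ + _)%N; case: k kn => [_|k kn].
  by rewrite big1 // => i _; rewrite muln0.
rewrite (bigD1 (Ordinal kn)) //= eqxx muln1 big1 ?addn0 // => i ik.
by rewrite eqSS eq_sym (_ : (i == k :> nat) = false) ?muln0 //; exact: negbTE.
Qed.

Lemma psizeE (n : nat) (l : intpart) : (psize l <= n)%N ->
  psize l = (\sum_(i < n) i.+1 * mult i.+1 l)%N.
Proof.
move=> ln; apply: sumn_count_mem; apply/allP => k /leq_mem_sumn kl.
exact: leq_trans kl ln.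
Qed.

(** * A uniform bound for finite sums of [r ^+ psize l] *)

Section SumBound.
Context {R : realType}.

(** The sum is at most [1 + t / (1 - t)], hence at most [1 + t / (1 - r)]. The exponential form
    turns a product of such bounds into a sum in the exponent. *)
Lemma geometric_le_expR (r t : R) (n : nat) : 0 <= t <= r -> r < 1 ->
  \sum_(j < n) t ^+ j <= expR (t / (1 - r)).
Proof.
move=> /andP[t0 tr] r1; apply: le_trans (expR_ge1Dx _).
have t1 : t < 1 := le_lt_trans tr r1.
have tn m : \sum_(j < m) t ^+ j <= (1 - t)^-1.
  rewrite -[leRHS]mul1r ler_pdivlMr ?subr_gt0 // mulrC -opprB mulNr -subrX1.
  by rewrite opprB gerBl exprn_ge0.
case: n => [|n]; first by rewrite big_ord0 addr_ge0 // divr_ge0 // subr_ge0 ltW.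
rewrite big_ord_recl expr0 lerD2l.
under eq_bigr do rewrite exprS.
rewrite -mulr_sumr ler_wpM2l // (le_trans (tn n)) //.
by rewrite lef_pV2 ?posrE ?subr_gt0 // lerD2l lerN2.
Qed.

Lemma partition_sum_bound (r : R) : 0 <= r < 1 -> exists M : R,
  forall J : {fset intpart}, \sum_(l <- J) r ^+ psize l <= M.
Proof.
(* The inner exponential bounds the sum of the powers of [r]; the outer one bounds the product, over
   part sizes [i], of the geometric sums in [r ^+ i]. *)
move=> /andP[r0 r1]; exists (expR (expR (r / (1 - r)) / (1 - r))) => J.
pose n := (\max_(l <- J) psize l)%N.
have ln (l : intpart) : l \in J -> (psize l <= n)%N.
  by move=> lJ; rewrite /n; apply: leq_bigmax_seq.
(* Partitions in [J] are encoded by their multiplicities, all at most [n], so [inord] never returns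
   its default. The sum is then enlarged to all functions and factors by distributivity. *)
pose m (l : intpart) : {ffun 'I_n -> 'I_n.+1} :=
  [ffun i : 'I_n => inord (mult i.+1 l)].
have mE l (i : 'I_n) : l \in J -> m l i = mult i.+1 l :> nat.
  by move=> lJ; rewrite ffunE inordK // ltnS (leq_trans (leq_mult_psize _ _)) ?ln.
have m_inj : {in J &, injective m}.
  move=> l l' lJ l'J ll'; apply: intpart_ext => -[//|k] _.
  have [kn|nk] := ltnP k n.
    by rewrite -(mE l (Ordinal kn)) // ll' mE.
  by rewrite !mult_gt_psize // ltnS (leq_trans _ nk) // ln.
pose G (f : {ffun 'I_n -> 'I_n.+1}) : R := \prod_(i < n) (r ^+ i.+1) ^+ f i.
have -> : \sum_(l <- J) r ^+ psize l = \sum_(f <- (m @` J)%fset) G f.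
  rewrite big_imfset //=; apply: eq_big_seq => l lJ.
  rewrite (psizeE n) ?ln // expr_sum; apply: eq_bigr => i _.
  by rewrite exprM mE.
have G0 f : 0 <= G f by apply: prodr_ge0 => i _; rewrite !exprn_ge0.
apply: (@le_trans _ _ (\sum_f G f)).
  rewrite big_uniq ?fset_uniq // [leRHS](bigID (mem (m @` J)%fset)) /=.
  by rewrite lerDl sumr_ge0.
rewrite /G -(bigA_distr_bigA (fun (i : 'I_n) (j : 'I_n.+1) => (r ^+ i.+1) ^+ j)).
apply: (@le_trans _ _ (\prod_(i < n) expR (r ^+ i.+1 / (1 - r)))).
  apply: ler_prod => i _; rewrite sumr_ge0 /=; last by move=> j _; rewrite !exprn_ge0.
  apply: geometric_le_expR => //.
  by rewrite exprn_ge0 //= exprS ler_piMr // exprn_ile1 // ltW.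
rewrite -expR_sum ler_expR -mulr_suml ler_pM2r ?invr_gt0 ?subr_gt0 //.
apply: le_trans (@geometric_le_expR r r n.+1 _ r1); last by rewrite r0 lexx.
by rewrite [leRHS]big_ord_recl lerDr expr0.
Qed.

End SumBound.

(** * Partitions from unsorted lists *)

Section PartitionOfMultiset.

Let geq_total : total geq. Proof. by move=> m n; exact: leq_total. Qed.

(** Filtering out zeros makes the construction total; a zero-free list is merely sorted. *)
Let parts_of_seq (s : seq nat) := sort geq [seq k <- s | (0 < k)%N].

Let parts_of_seqP (s : seq nat) :
  sorted geq (parts_of_seq s) && (0%N \notin parts_of_seq s).
Proof. by rewrite sort_sorted //= mem_sort mem_filter. Qed.

Definition intpart_of_seq (s : seq nat) : intpart := IntPart (parts_of_seqP s).

Lemma perm_intpart_of_seq (s : seq nat) :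
  0%N \notin s -> perm_eq (intpart_of_seq s) s.
Proof.
move=> s0; rewrite /= /parts_of_seq perm_sort (_ : [seq k <- s | _] = s) //.
by apply/all_filterP/allP => -[|k] // ks; rewrite ks in s0.
Qed.

End PartitionOfMultiset.

Lemma mult_intpart_of_seq (k : nat) (s : seq nat) :
  0%N \notin s -> mult k (intpart_of_seq s) = count_mem k s.
Proof. by move=> /perm_intpart_of_seq/permP; exact. Qed.

Lemma plength_intpart_of_seq (s : seq nat) :
  0%N \notin s -> plength (intpart_of_seq s) = size s.
Proof. by move=> /perm_intpart_of_seq/perm_size. Qed.

Lemma psize_intpart_of_seq (s : seq nat) :
  0%N \notin s -> psize (intpart_of_seq s) = sumn s.
Proof. by move=> /perm_intpart_of_seq/perm_sumn. Qed.

Lemma intpart0 (l : intpart) : 0%N \notin parts l.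
Proof. by case/andP: (valP l). Qed.

Lemma mem_mult (k : nat) (l : intpart) : (k \in parts l) = (0 < mult k l)%N.
Proof. by rewrite -has_pred1 has_count. Qed.

(** * Adding copies of one part *)

Definition add_parts (c k : nat) (l : intpart) : intpart :=
  intpart_of_seq (nseq c k ++ l).

Section AddParts.
Context (c k : nat) (k0 : (0 < k)%N).

Let nseq0 (l : intpart) : 0%N \notin nseq c k ++ l.
Proof.
by rewrite mem_cat mem_nseq negb_or intpart0 andbT negb_and neq_ltn k0 orbT.
Qed.

Lemma mult_add_parts (j : nat) (l : intpart) :
  mult j (add_parts c k l) = ((k == j) * c + mult j l)%N.
Proof. by rewrite mult_intpart_of_seq // count_cat count_nseq. Qed.

Lemma plength_add_parts (l : intpart) :
  plength (add_parts c k l) = (c + plength l)%N.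
Proof. by rewrite plength_intpart_of_seq // size_cat size_nseq. Qed.

Lemma psize_add_parts (l : intpart) :
  psize (add_parts c k l) = (c * k + psize l)%N.
Proof. by rewrite psize_intpart_of_seq // sumn_cat sumn_nseq mulnC. Qed.

Lemma add_parts_inj : injective (add_parts c k).
Proof.
move=> l m lm; apply: intpart_ext => j _; apply: (@addnI ((k == j) * c)%N).
by rewrite -!mult_add_parts lm.
Qed.

Lemma range_add_parts (l : intpart) :
  (c <= mult k l)%N -> range (add_parts c k) l.
Proof.
move=> cl; pose s := nseq (mult k l - c) k ++ [seq j <- parts l | j != k].
have s0 : 0%N \notin s.
  rewrite mem_cat mem_nseq mem_filter !negb_or !negb_and intpart0 orbT andbT.
  by rewrite neq_ltn k0 orbT.
exists (intpart_of_seq s) => //; apply: intpart_ext => j _.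
rewrite mult_add_parts mult_intpart_of_seq // count_cat count_nseq count_filter /=.
have [<-|kj] := eqVneq k j.
  rewrite !mul1n (eq_count (a2 := pred0)) ?count_pred0 ?addn0 ?subnKC //.
  by move=> i /=; case: eqP.
rewrite !mul0n !add0n; apply: eq_count => i /=.
by have [->|//] := eqVneq i j; rewrite eq_sym kj.
Qed.

End AddParts.

(** * Admissible partitions with parts among the first [n] values of [b] *)

Section PartsBelow.
Context (a b : nat -> nat).
Hypotheses (ha : forall i, (0 < a i)%N) (hb : forall i, (0 < b i)%N).
Hypothesis hb_inj : injective b.

Definition parts_in_mult_below (n : nat) : set intpart :=
  parts_in_mult b a `&` parts_in (b @` `I_n).

Local Notation PB := parts_in_mult_below.

Lemma parts_in_mult_below0 : PB 0 = [set intpart_of_seq [::]].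
Proof.
apply/seteqP; split=> [l [_ l0]|_ -> /=].
  apply: intpart_ext => k _; rewrite mult_intpart_of_seq //=.
  apply/eqP; rewrite -leqn0 leqNgt -mem_mult; apply/negP => kl.
  by have [i /=] := l0 _ kl; rewrite ltn0.
split; last by move=> k.
by split=> [k //|i /=]; rewrite mult_intpart_of_seq.
Qed.

Lemma parts_in_mult_below_sub (n : nat) (l : intpart) : PB n l -> PB n.+1 l.
Proof.
move=> [lP lb]; split=> // k /lb[i /= ik <-].
by exists i => //=; exact: leqW.
Qed.

(** A partition has finitely many parts, so one bound exceeds all the indices in use. *)
Lemma parts_in_mult_below_exhausts (l : intpart) :
  parts_in_mult b a l -> \forall n \near \oo, PB n l.
Proof.
move=> lP; have [lb _] := lP; suff: \forall n \near \oo, parts_in (b @` `I_n) l.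
  by apply: filterS => n ln; split.
have: forall k, k \in parts l -> exists2 i, True & b i = k.
  by move=> k kl; have [i _ ik] := lb _ kl; exists i.
rewrite /parts_in /=; elim: (parts l) => [|j s IH] jb.
  by apply: nearW => n k.
have [i _ <-] := jb j (mem_head _ _).
have [|m _ mP] := IH; first by move=> k ks; apply: jb; rewrite inE ks orbT.
exists (maxn i.+1 m) => // n /=; rewrite geq_max => /andP[im nm] k.
by rewrite inE => /orP[/eqP->|]; [exists i|exact: mP].
Qed.

(** As [b] is injective, only the multiplicity at index [n] changes, and by exactly [a n], so every
    divisibility condition is preserved in both directions. *)
Lemma add_parts_below (n : nat) (l : intpart) :
  PB n.+1 (add_parts (a n) (b n) l) <-> PB n.+1 l.
Proof.
have dvdE i : (a i %| mult (b i) (add_parts (a n) (b n) l))%N =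
              (a i %| mult (b i) l)%N.
  rewrite mult_add_parts //; have [/hb_inj->|_] := eqVneq; last by [].
  by rewrite mul1n dvdn_addr.
have memE k :
    k \in parts (add_parts (a n) (b n) l) = (b n == k) || (k \in parts l).
  by rewrite !mem_mult mult_add_parts // addn_gt0 muln_gt0 ha andbT lt0b.
split=> -[[lb la] lbn]; split; [split| |split|].
- by move=> k kl; apply: lb; rewrite memE kl orbT.
- by move=> i /=; rewrite -dvdE.
- by move=> k kl; apply: lbn; rewrite memE kl orbT.
- by move=> k; rewrite memE => /orP[/eqP<-|kl]; [exists n|exact: lb].
- by move=> i /=; rewrite dvdE.
- by move=> k; rewrite memE => /orP[/eqP<-|kl]; [exists n => /=|exact: lbn].
Qed.

Lemma add_parts_not_below (n : nat) (l : intpart) :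
  ~ PB n (add_parts (a n) (b n) l).
Proof.
move=> [_] /(_ (b n)); rewrite mem_mult mult_add_parts // eqxx mul1n.
rewrite (leq_trans (ha n) (leq_addr _ _)) => /(_ isT)[i /= + /hb_inj ni].
by rewrite ni ltnn.
Qed.

(** If [b n] were not a part, [l] would already lie in the smaller set. So its multiplicity is
    positive and divisible by [a n], hence at least [a n]. *)
Lemma range_add_parts_below (n : nat) (l : intpart) :
  PB n.+1 l -> ~ PB n l -> range (add_parts (a n) (b n)) l.
Proof.
move=> [lP lb] nPl; apply: range_add_parts => //; apply: dvdn_leq; last exact: lP.2.
rewrite -mem_mult; apply: contra_notT nPl => nl; split=> // k kl.
have [i /=] := lb _ kl; rewrite ltnS leq_eqVlt => /orP[/eqP->|i_n] ik.
  by rewrite -ik (negbTE nl) in kl.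
by exists i.
Qed.

End PartsBelow.

(** * The product and the power series as sums over partitions *)

Section GeneratingFunction.
Context {R : realType} (x q : C R) (a b : nat -> nat).
Hypotheses (hx : `|x| < 1) (hq : `|q| < 1).
Hypotheses (ha : forall i, (0 < a i)%N) (hb : forall i, (0 < b i)%N).
Hypothesis hb_inj : injective b.

Local Notation PB := (parts_in_mult_below a b).

Lemma usum_partitions (g : intpart -> C R) :
  (forall l, `|g l| <= `|q| ^+ psize l) ->
  exists s : C R, partial_sum g @ totally --> s.
Proof.
(* The modulus of [q] is typed as a complex number; its real part is the real ratio to which the
   partition bound applies. *)
move=> gq; have qE : `|q| = (complex.Re `|q|)%:C by rewrite RRe_real ?normr_real.
have r01 : 0 <= complex.Re `|q| < 1.
  by rewrite -lecR -ltcR -qE normr_ge0.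
have [M MP] := partition_sum_bound _ r01.
apply: usum_dominated MP => l; apply: le_trans (gq l) _.
by rewrite rmorphXn /= -qE.
Qed.

Definition weight (l : intpart) : C R := x ^+ plength l * q ^+ psize l.

Lemma usum_weight (A : set intpart) :
  exists s : C R, partial_sum (zext A weight) @ totally --> s.
Proof.
apply: usum_partitions => l; rewrite /patch; case: ifP => _.
  by rewrite normrM !normrX ler_piMl ?exprn_ge0 // exprn_ile1 // ltW.
by rewrite normr0 exprn_ge0.
Qed.

Lemma usum_qpow (A : set intpart) :
  exists s : C R,
    partial_sum (zext A (fun l => q ^+ psize l)) @ totally --> s.
Proof.
apply: usum_partitions => l; rewrite /patch; case: ifP => _.
  by rewrite normrX.
by rewrite normr0 exprn_ge0.
Qed.

Lemma factor_neq0 (n : nat) : 1 - x ^+ a n * q ^+ (a n * b n) != 0.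
Proof.
have y1 : `|x ^+ a n * q ^+ (a n * b n)| < 1.
  rewrite normrM !normrX mulr_ilt1 ?exprn_ge0 // exprn_ilt1 // -lt0n //.
  by rewrite muln_gt0 ha hb.
by rewrite subr_eq0; apply: contraTneq y1 => <-; rewrite normr1 ltxx.
Qed.

(* Adding [a n] copies of [b n] maps [PB n.+1] bijectively onto the
   partitions of [PB n.+1] having the part [b n], so [t - s = x ^ a_n * q ^ (a_n b_n) * t]. *)
Lemma usum_below_succ (n : nat) (s t : C R) :
  partial_sum (zext (PB n) weight) @ totally --> s ->
  partial_sum (zext (PB n.+1) weight) @ totally --> t ->
  t = s * (1 / (1 - x ^+ a n * q ^+ (a n * b n))).
Proof.
move=> sP tP; set y := x ^+ a n * _.
pose h := add_parts (a n) (b n).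
pose g l : C R := zext (PB n.+1) weight l - zext (PB n) weight l.
have gP : partial_sum g @ totally --> t - s by exact: (usumB _ _ _ _ tP sP).
have gh : g \o h = fun l => y *: zext (PB n.+1) weight l.
  apply/funext => l; rewrite /g /h /patch /=.
  rewrite (memNset (add_parts_not_below a b ha hb hb_inj n l)) subr0.
  have [lP|nlP] := pselect (PB n.+1 l).
    rewrite !mem_set //; last exact/add_parts_below.
    rewrite /weight plength_add_parts // psize_add_parts // !exprD.
    by rewrite mulrACA.
  rewrite !memNset ?scaler0 // => hl; apply: nlP.
  exact/add_parts_below/hl.
have := usum_comp_inj h g (t - s) (add_parts_inj _ _ (hb n)) _ gP.
rewrite gh => /(_ _)/usum_unique/(_ (usumZ y _ _ tP)) ts.
have {}ts : t - s = y * t.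
  apply: ts => l; rewrite /g /patch.
  have [lP|nlP] := pselect (PB n.+1 l); last first.
    rewrite !memNset ?subrr ?eqxx // => lP; apply: nlP.
    exact: parts_in_mult_below_sub.
  have [lP'|nlP'] := pselect (PB n l); first by rewrite !mem_set // subrr eqxx.
  by move=> _; exact: range_add_parts_below.
apply/(mulIf (factor_neq0 n)); rewrite -mulrA div1r mulVf ?factor_neq0 //.
by rewrite mulr1 mulrBr mulr1 mulrC -ts subKr.
Qed.

(** The induction starts at the empty partition, of weight 1, which matches the empty product. *)
Lemma usum_below (n : nat) :
  partial_sum (zext (PB n) weight) @ totally -->
  \prod_(i < n) (1 / (1 - x ^+ a i * q ^+ (a i * b i))).
Proof.
elim: n => [|n IH].
  rewrite big_ord0 parts_in_mult_below0; apply/usumP => e e0.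
  exists [fset intpart_of_seq [::]]%fset => L L0.
  rewrite -(big_fset_incl _ L0); last first.
    by move=> l _; rewrite inE /patch => l0; rewrite memNset // => /eqP; exact/negP.
  rewrite big_seq_fset1 /patch mem_set // /weight.
  by rewrite plength_intpart_of_seq // psize_intpart_of_seq //=
    !expr0 mulr1 subrr normr0.
have [t tP] := usum_weight (PB n.+1).
by rewrite big_ord_recr /= -(usum_below_succ _ _ _ IH tP).
Qed.

Lemma prod_cvg (s : C R) :
  partial_sum (zext (parts_in_mult b a) weight) @ totally --> s ->
  (\prod_(i < n) (1 / (1 - x ^+ a i * q ^+ (a i * b i)))) @[n --> \oo] --> s.
Proof.
move=> sP; apply: (usum_exhaustion _ (fun n => zext (PB n) weight) _ _ _ _ sP).
- move=> n l; rewrite /patch; case: ifPn => lP; last by right.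
  by left; rewrite mem_set //; case/set_mem: lP.
- move=> l; have [lP|nlP] := pselect (parts_in_mult b a l).
    apply: filterS (parts_in_mult_below_exhausts _ _ _ lP) => n lPn.
    by rewrite /patch !mem_set.
  by apply: nearW => n; rewrite /patch !memNset // => -[].
- exact: usum_below.
Qed.

Lemma series_cvg (s : C R) (c : nat -> C R) :
  partial_sum (zext (parts_in_mult b a) weight) @ totally --> s ->
  (forall n, partial_sum (zext (parts_in_mult_len b a n) (fun l => q ^+ psize l))
    @ totally --> c n) ->
  (\sum_(0 <= n < N) x ^+ n * c n) @[N --> \oo] --> s.
Proof.
(* The strict inequality matches the partial sum over [0 <= n < N], which collects the lengths below
   [N]. *)
move=> sP cP; pose Q n := parts_in_mult b a `&` [set l | plength l < n]%N.
apply: (usum_exhaustion _ (fun n => zext (Q n) weight) _ _ _ _ sP).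
- move=> n l; rewrite /patch; case: ifPn => lP; last by right.
  by left; rewrite mem_set //; case/set_mem: lP.
- move=> l; have [lP|nlP] := pselect (parts_in_mult b a l).
    by exists (plength l).+1 => // n /= ln; rewrite /patch !mem_set.
  by apply: nearW => n; rewrite /patch !memNset // => -[].
elim=> [|n IH].
  rewrite big_nil (_ : zext _ _ = fun=> 0).
    apply/usumP => e e0; exists fset0 => L _.
    by rewrite big1 // subr0 normr0.
  by apply/funext => l; rewrite /patch memNset // => -[_] /=; rewrite ltn0.
rewrite big_nat_recr; last exact: leq0n.
(* Passing to [Q n.+1] adds the partitions of length [n], whose weights share the factor
   [x ^+ n]. *)
have -> : zext (Q n.+1) weight = fun l => zext (Q n) weight l +
    x ^+ n *: zext (parts_in_mult_len b a n) (fun l => q ^+ psize l) l.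
  apply/funext => l; rewrite /patch.
  have [lP|nlP] := pselect (parts_in_mult b a l); last first.
    by rewrite !memNset ?scaler0 ?addr0 // => -[].
  have [ln|nl|ln] := ltngtP (plength l) n.
  - rewrite (@mem_set _ (Q n)) // (@mem_set _ (Q n.+1)); last first.
      by split=> //=; exact: leqW.
    rewrite memNset ?scaler0 ?addr0 // => -[_] /= E.
    by rewrite E ltnn in ln.
  - rewrite !memNset ?scaler0 ?addr0 // => -[_] /= h; move: nl.
    + by rewrite h ltnn.
    + by rewrite ltnNge (ltnW h).
    + by rewrite ltnNge -ltnS h.
  - rewrite (@memNset _ (Q n)) ?add0r; last by move=> [_] /=; rewrite ln ltnn.
    rewrite (@mem_set _ (Q n.+1)) ?mem_set //; last by split=> //=; rewrite ln.
    by rewrite /weight ln.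
exact: (usumD _ _ _ _ IH (usumZ (x ^+ n) _ _ (cP n))).
Qed.

End GeneratingFunction.

(** * The bijection between partitions with parts [a i] and admissible partitions *)

Section Bijection.
Context (a b : nat -> nat).
Hypotheses (ha : forall i, (0 < a i)%N) (hb : forall i, (0 < b i)%N).
Hypotheses (ha_inj : injective a) (hb_inj : injective b).

(** Left inverse of an injective [t], with default value 0 off its range. *)
Let index_of (t : nat -> nat) (k : nat) : nat := xget 0%N [set i | t i = k].

Let index_ofK (t : nat -> nat) : injective t -> cancel t (index_of t).
Proof. by move=> tinj i; rewrite /index_of; case: xgetP => [j _ /tinj|/(_ i)[]]. Qed.

(* Each part [a i] becomes [a i] copies of [b i]. *)
Definition split_parts (l : intpart) : intpart :=
  intpart_of_seq
    (flatten [seq nseq k (b (index_of a k)) | k <- parts l]).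

Let split_seq0 (s : seq nat) :
  0%N \notin flatten [seq nseq k (b (index_of a k)) | k <- s].
Proof.
elim: s => //= k s IH; rewrite mem_cat negb_or IH andbT mem_nseq negb_and.
by rewrite neq_ltn hb orbT.
Qed.

(** A part [k] is replaced by exactly [k] parts, whatever their common value. *)
Lemma plength_split_parts (l : intpart) : plength (split_parts l) = psize l.
Proof.
rewrite plength_intpart_of_seq // size_flatten /shape -map_comp /psize.
rewrite (eq_map (g := id)) ?map_id // => k /=.
by rewrite size_nseq.
Qed.

(** By injectivity of [a] and [b], only the parts equal to [a i] produce copies of [b i], and each
    produces [a i] of them. *)
Lemma mult_split_parts (i : nat) (l : intpart) : parts_in (range a) l ->
  mult (b i) (split_parts l) = (a i * mult (a i) l)%N.
Proof.
rewrite mult_intpart_of_seq // /parts_in /mult /=.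
elim: (parts l) => [|k s IH] sa /=; first by rewrite muln0.
rewrite count_cat count_nseq IH; last by move=> j js; apply: sa; rewrite inE js orbT.
have [j _ <-] := sa k (mem_head _ _); rewrite index_ofK // mulnDr; congr (_ + _)%N.
have [->|ij] := eqVneq i j; first by rewrite /= !eqxx mul1n muln1.
by rewrite /= !inj_eq // eq_sym (negbTE ij) muln0.
Qed.

Lemma split_parts_in (l : intpart) :
  parts_in (range a) l -> parts_in_mult b a (split_parts l).
Proof.
move=> la; split=> [k|i /=]; last by rewrite mult_split_parts // dvdn_mulr.
rewrite (perm_mem (perm_intpart_of_seq _ (split_seq0 _))).
case/flatten_mapP => j _; rewrite mem_nseq => /andP[_ /eqP->].
by exists (index_of a j).
Qed.

(** The multiplicity of [a i] is recovered by cancelling the positive factor [a i]; values off the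
    range of [a] do not occur as parts. *)
Lemma split_parts_inj :
  {in parts_in (range a) &, injective split_parts}.
Proof.
move=> l m /set_mem /= la /set_mem /= ma lm; apply: intpart_ext => k _.
have [[i _ <-]|nak] := pselect (range a k).
  by apply/eqP; rewrite -(eqn_pmul2l (ha i)) -!mult_split_parts // lm.
have mult0 p : parts_in (range a) p -> mult k p = 0%N.
  by move=> pa; apply/count_memPn; apply: contra_notN nak => /pa.
by rewrite !mult0.
Qed.

Lemma split_parts_surj (m : intpart) : parts_in_mult b a m ->
  exists2 l, parts_in (range a) l & split_parts l = m.
Proof.
move=> [mb ma].
(* Inverse construction: the copies of [v = b i] in [m] are grouped into blocks of [a i], each
   becoming one part [a i]. The quotient is exact by admissibility, and [undup] handles each
   distinct part once. *)
pose block v := let i := index_of b v in nseq (mult v m %/ a i) (a i).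
pose s := flatten [seq block v | v <- undup (parts m)].
have sP k : k \in s -> range a k.
  case/flatten_mapP => v _; rewrite mem_nseq => /andP[_ /eqP->].
  by exists (index_of b v).
have s0 : 0%N \notin s.
  by apply/negP => /sP[i _ ai]; have := ha i; rewrite ai.
have la : parts_in (range a) (intpart_of_seq s).
  by move=> k; rewrite (perm_mem (perm_intpart_of_seq _ s0)); exact: sP.
exists (intpart_of_seq s) => //; apply: intpart_ext => k _.
have [[i _ <-]|nbk] := pselect (range b k); last first.
  rewrite /mult (count_memPn _); last first.
    by apply/negP => /(split_parts_in _ la).1.
  by rewrite (count_memPn _) //; apply/negP => /mb.
rewrite mult_split_parts // mult_intpart_of_seq //.
suff -> : count_mem (a i) s = (mult (b i) m %/ a i)%N.
  by rewrite mulnC divnK //; exact: ma.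
have blockE j : count_mem (a i) (block (b j)) =
     ((i == j) * (mult (b i) m %/ a i))%N.
  rewrite /block index_ofK // count_nseq /= inj_eq // eq_sym.
  by case: eqVneq => [->|].
rewrite /s count_flatten -map_comp sumnE big_map /=.
have block0 v :
    v \in undup (parts m) -> v != b i -> count_mem (a i) (block v) = 0%N.
  rewrite mem_undup => vm; have [j _ <-] := mb _ vm; rewrite blockE.
  by rewrite inj_eq // eq_sym => /negbTE->.
(* Only the block of [b i] can contain [a i], so the sum has at most one nonzero term. *)
have [bm|nbm] := boolP (b i \in undup (parts m)).
  rewrite (bigD1_seq _ bm (undup_uniq _)) /= blockE eqxx mul1n big_seq_cond.
  by rewrite big1 ?addn0 // => v /andP[vm vi]; exact: block0.
have -> : mult (b i) m = 0%N by apply/count_memPn; rewrite -mem_undup.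
rewrite div0n big_seq big1 // => v vm.
by apply: block0 => //; apply: contraNneq nbm => <-.
Qed.

Lemma split_parts_bij :
  set_bij (parts_in (range a)) (parts_in_mult b a) split_parts.
Proof.
split; [by move=> l; exact: split_parts_in|exact: split_parts_inj|].
by move=> m /split_parts_surj[l la <-]; exists l.
Qed.

Lemma card_parts_in_mult_len (n : nat) :
  parts_in_mult_len b a n #= `I_(npart (range a) n).
Proof.
(* Size becomes length, so the bijection restricts to partitions of [n] on one side and of length
   [n] on the other. *)
have -> : parts_in_mult_len b a n = split_parts @` parts_in_of (range a) n.
  apply/seteqP; split=> [m [/split_parts_surj[l la <-] lm]|_ [l [la ln] <-]].
    by exists l => //; split=> //=; rewrite -plength_split_parts.
  by split; [exact: split_parts_in|rewrite /= plength_split_parts].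
have inj : {in parts_in_of (range a) n &, injective split_parts}.
  move=> l m /set_mem[la _] /set_mem[ma _].
  by apply: split_parts_inj; rewrite inE.
apply: card_eq_trans (inj_card_eq inj) _.
rewrite -[X in X #= _](fset_setK (finite_parts_in_of (range a) n)).
exact/card_eq_fsetP.
Qed.

End Bijection.

Theorem theorem4p5 (R : realType) (x q : C R) (a b : nat -> nat)
    (hx : `|x| < 1) (hq : `|q| < 1)
    (ha : forall i, (0 < a i)%N) (hb : forall i, (0 < b i)%N)
    (hb_inj : injective b) :
  (exists (s : C R) (c : nat -> C R),
    [/\ (\prod_(i < N) (1 / (1 - x ^+ a i * q ^+ (a i * b i)))) @[N --> \oo]
          --> s,
        has_sum (parts_in_mult b a)
          (fun l => x ^+ plength l * q ^+ psize l) s,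
        (forall n, has_sum (parts_in_mult_len b a n)
          (fun l => q ^+ psize l) (c n))
      & (\sum_(0 <= n < N) x ^+ n * c n) @[N --> \oo] --> s]) /\
  (injective a ->
    (exists f : intpart -> intpart,
      set_bij (parts_in (range a)) (parts_in_mult b a) f) /\
    (forall n, parts_in_mult_len b a n #= `I_(npart (range a) n))).
Proof.
split=> [|ha_inj]; last first.
  split; last exact: card_parts_in_mult_len.
  by exists (split_parts a b); exact: split_parts_bij.
(* The product and the power series both converge to this [s], the unconditional sum of the weights
   of all admissible partitions. *)
have [s sP] := usum_weight x q hx hq (parts_in_mult b a).
have /choice[c cP] n := usum_qpow q hq (parts_in_mult_len b a n).
exists s, c; split.
- exact: prod_cvg sP.
- exact: has_sum_patch sP.
- by move=> n; exact: has_sum_patch (cP n).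
- exact: series_cvg sP cP.
Qed.
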